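(* Let $w=w(a,b)=b\,a^{r_1}b^{-1}a^{r_2}b\cdots b\,a^{r_{2m-1}}b^{-1}$ (the exponents of $b$ alternate $+1,-1,\dots,+1,-1$; the $r_j$ are integers with $r_1+\cdots+r_{2m-1}$ even) be a regular balanced even word. Then there are polynomials $r_w,s_w,t_w,\omega_w$ in two variables $x,z$ such that $$2r_w,\;2s_w,\;2t_w,\;2\omega_w,\;r_w-s_w,\;t_w-\omega_w\in\mathbb{Z}[x,z],\qquad r_w(0,0)=1,$$ $$g_w(x,z):=\frac{s_w(x,z)-z\,\omega_w(x,z)}{x}\ \text{ is also a polynomial,}$$ and such that the following holds for all non-identity $f,g\in\mathrm{Isom}^+(\mathbb{H}^3)$ with parameters $\beta=\beta(f)$, $\beta'=\beta(g)$, $\gamma=\gamma(f,g)$, where $A,B$ are the canonical matrices (see context) which represent, up to conjugacy, $f$ and $g$. (i) If $f$ is non-parabolic ($\beta\ne0$), then with $Q=\sqrt{\beta(\beta+4)}$ and $a,b,c,d$ the entries of $B=\begin{pmatrix}a&b\\c&d\end{pmatrix}$, $$w(A,B)=\begin{pmatrix} r_w(\beta,\gamma)+\frac{s_w(\beta,\gamma)Q}{\beta} & ab\,[\beta t_w(\beta,\gamma)+\omega_w(\beta,\gamma)Q]\\ cd\,[\beta t_w(\beta,\gamma)-\omega_w(\beta,\gamma)Q] & r_w(\beta,\gamma)-\frac{s_w(\beta,\gamma)Q}{\beta}\end{pmatrix}.$$ (ii) If $f$ is parabolic ($\beta=0$) and $\gamma\neq0$, then $$w(A,B)=\begin{pmatrix}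 r_w(0,\gamma)+\gamma t_w(0,\gamma)&4g_w(0,\gamma)+2\omega_w(0,\gamma)\\2\gamma\,\omega_w(0,\gamma)&r_w(0,\gamma)-\gamma t_w(0,\gamma)\end{pmatrix}.$$ (iii) If $f$ is parabolic and $\gamma=0$, then $$w(A,B)=\begin{pmatrix}1&4g_w(0,0)-\big(\beta'+\sqrt{\beta'}\sqrt{\beta'+4}\big)\omega_w(0,0)\\0&1\end{pmatrix}.$$ In particular, $\mathrm{tr}(w(f,g))=2r_w(\beta,\gamma)$, where $2r_w\in\mathbb{Z}[x,z]$.
   Context: $\mathrm{Isom}^+(\mathbb{H}^3)\cong PSL(2,\mathbb{C})$; for isometries $f,g$ represented by $A,B\in SL(2,\mathbb{C})$, $\beta(f)=\mathrm{tr}^2(A)-4$ and $\gamma(f,g)=\mathrm{tr}(ABA^{-1}B^{-1})-2$. Square roots are principal. Good words: a good word is $b^{s_1}a^{r_1}b^{s_2}a^{r_2}\cdots a^{r_{m-1}}b^{s_m}$ with $s_1=\pm1$, $s_j=(-1)^{j+1}s_1$, $r_j\in\mathbb{Z}$ (possibly $0$); it is even if $\sum r_j$ is even, balanced if $m$ is even, regular if $s_1=1$. Canonical matrices with parameters $(\beta,\beta',\gamma)$: If $\beta\ne0$: $A=\mathrm{diag}\Big(\frac{\sqrt{\beta(\beta+4)}+\beta}{2\sqrt\beta},\frac{\sqrt{\beta(\beta+4)}-\beta}{2\sqrt\beta}\Big)$, $B=\begin{pmatrix}a&b\\c&d\end{pmatrix}$ with $a=\frac12\big(\sqrt{\beta'+4}+\sqrt{(4\gamma+\beta\beta')/\beta}\big)$,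 $d=\frac12\big(\sqrt{\beta'+4}-\sqrt{(4\gamma+\beta\beta')/\beta}\big)$, and $c=-b=\sqrt{\gamma/\beta}$ if $\gamma\neq0$, while $(b,c)\in\{(0,1),(1,0),(0,0)\}$ if $\gamma=0$. If $\beta=0$, $\gamma\ne0$: $A=\begin{pmatrix}1&1\\0&1\end{pmatrix}$, $B=\begin{pmatrix}0&-1/\sqrt\gamma\\ \sqrt\gamma&\sqrt{\beta'+4}\end{pmatrix}$. If $\beta=\gamma=0$: $A=\begin{pmatrix}1&1\\0&1\end{pmatrix}$, $B=\begin{pmatrix}\frac12(\sqrt{\beta'+4}+\sqrt{\beta'})&\ell\\0&\frac12(\sqrt{\beta'+4}-\sqrt{\beta'})\end{pmatrix}$, with $\ell=0$ if $\beta'\ne0$ and $\ell\in\mathbb{C}$ arbitrary if $\beta'=0$. Every pair of non-identity isometries generates a group conjugate to one generated by such a canonical pair. *)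

(* Defs.v *)
From HB Require Import structures.
From mathcomp Require Import all_boot all_order all_algebra.
From mathcomp Require Import generic_quotient.
From mathcomp Require Import reals.
From mathcomp Require Import complex mpoly.

Set Implicit Arguments.
Unset Strict Implicit.
Unset Printing Implicit Defensive.
Import Order.TTheory GRing.Theory Num.Theory.
Local Open Scope ring_scope.
Local Open Scope complex_scope.
Local Open Scope quotient_scope.

Definition mx22 (K : nzRingType) (a b c d : K) : 'M[K]_2 :=
  \matrix_(i < 2, j < 2)
    if i == 0 then (if j == 0 then a else b) else (if j == 0 then c else d).

(** [Isom^+(H^3)] is identified with [PSL(2,C)], the quotient of [SL(2,C)]
    by the equivalence [M ~ N <-> M = N \/ M = - N]. *)

Section PSL2.
Variable R : realType.

Definition SL2 := {M : 'M[R[i]]_2 | \det M == 1}.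

Definition psl_rel : rel SL2 :=
  fun M N => (val M == val N) || (val M == - val N).

Lemma psl_rel_refl : reflexive psl_rel.
Proof. by move=> M; rewrite /psl_rel eqxx. Qed.

Lemma psl_rel_sym : ssrbool.symmetric psl_rel.
Proof.
by move=> M N; rewrite /psl_rel [val M == val N]eq_sym [val N == - _]eq_sym
  eqr_oppLR.
Qed.

Lemma psl_rel_trans : transitive psl_rel.
Proof.
move=> N M P; rewrite /psl_rel.
by case/orP=> /eqP-> /orP[] /eqP->; rewrite ?opprK eqxx ?orbT.
Qed.

Canonical psl_equiv := EquivRel psl_rel psl_rel_refl psl_rel_sym psl_rel_trans.

Definition PSL2 := {eq_quot psl_equiv}.

Lemma det1_mx2 : \det (1 : 'M[R[i]]_2) == 1.
Proof. by rewrite det1. Qed.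

Definition PSL2_one : PSL2 := \pi_PSL2 (exist _ 1 det1_mx2 : SL2).

Definition represents (f : PSL2) (M : 'M[R[i]]_2) : Prop :=
  exists2 M' : SL2, val M' = M & f = \pi_PSL2 M'.

Definition beta (f : PSL2) : R[i] := (\tr (val (repr f))) ^+ 2 - 4.

Definition gamma (f g : PSL2) : R[i] :=
  let A := val (repr f) in let B := val (repr g) in
  \tr (A * B * A^-1 * B^-1) - 2.

Lemma repr_represents (f : PSL2) (M : 'M[R[i]]_2) :
  represents f M -> val (repr f) = M \/ val (repr f) = - M.
Proof.
move=> [M' <- fE]; have /eqP : \pi_PSL2 (repr f) = \pi_PSL2 M' by rewrite reprK.
by rewrite piE => /orP[] /eqP; [left | right].
Qed.

Lemma beta_represents (f : PSL2) (A : 'M[R[i]]_2) :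
  represents f A -> beta f = (\tr A) ^+ 2 - 4.
Proof.
by rewrite /beta => /repr_represents[] ->; rewrite ?raddfN ?sqrrN.
Qed.

Lemma gamma_represents (f g : PSL2) (A B : 'M[R[i]]_2) :
  represents f A -> represents g B ->
  gamma f g = \tr (A * B * A^-1 * B^-1) - 2.
Proof.
rewrite /gamma => /repr_represents[] -> /repr_represents[] ->.
- by [].
- by rewrite invrN !(mulNr, mulrN) ?opprK.
- by rewrite invrN !(mulNr, mulrN) ?opprK.
- by rewrite !invrN !(mulNr, mulrN) ?opprK.
Qed.

End PSL2.

(** [sqrtc] is the principal square root: nonnegative real part, and
    nonnegative imaginary part on the negative real axis. *)

Section Canonical.
Variable R : realType.
Implicit Types (be ga : R[i]) (A B : 'M[R[i]]_2).

Definition canonA be : 'M[R[i]]_2 :=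
  mx22 ((sqrtc (be * (be + 4)) + be) / (2 * sqrtc be)) 0
       0 ((sqrtc (be * (be + 4)) - be) / (2 * sqrtc be)).

Definition unipA : 'M[R[i]]_2 := mx22 1 1 0 1.

Definition canonical_pair be (be' : R[i]) ga A B : Prop :=
  [\/ [/\ be != 0, A = canonA be &
        exists b c : R[i],
          (if ga != 0 then c = sqrtc (ga / be) /\ b = - c
           else (b, c) \in [:: (0, 1); (1, 0); (0, 0)]) /\
          B = mx22
                ((sqrtc (be' + 4) + sqrtc ((4 * ga + be * be') / be)) / 2) b
                c ((sqrtc (be' + 4) - sqrtc ((4 * ga + be * be') / be)) / 2)],
      [/\ be = 0, ga != 0, A = unipA &
        B = mx22 0 (- 1 / sqrtc ga) (sqrtc ga) (sqrtc (be' + 4))]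
    | [/\ be = 0, ga = 0, A = unipA &
        exists l : R[i], (be' != 0 -> l = 0) /\
          B = mx22 ((sqrtc (be' + 4) + sqrtc be') / 2) l
                   0 ((sqrtc (be' + 4) - sqrtc be') / 2)]].

(** Because of the fixed branches of the square roots, a pair [(f, g)] is in
    general conjugate to a canonical pair only after replacing [f] or [g] by
    its inverse (which changes neither the parameters nor the group generated
    by the pair). *)
Definition represents_up_to_conj (f g : PSL2 R) A B : Prop :=
  exists2 P : 'M[R[i]]_2, \det P = 1 &
    (represents f (P * A * P^-1) \/ represents f (P * A^-1 * P^-1)) /\
    (represents g (P * B * P^-1) \/ represents g (P * B^-1 * P^-1)).

End Canonical.

(** [GoodWord e [:: r_1; ...; r_(m-1)]] stands for
    [b^(s_1) a^(r_1) b^(s_2) ... a^(r_(m-1)) b^(s_m)] with [s_1 = (-1)^e]. *)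

Record good_word := GoodWord { gw_sign : bool; gw_exps : seq int }.

Definition gw_s1 (w : good_word) : int := (-1) ^+ gw_sign w.
Definition gw_m (w : good_word) : nat := (size (gw_exps w)).+1.

Definition regular_word (w : good_word) : Prop := gw_s1 w = 1.
Definition balanced_word (w : good_word) : Prop := ~~ odd (gw_m w).
Definition even_word (w : good_word) : Prop :=
  (2 %| \sum_(k <- gw_exps w) k)%Z.

Fixpoint alt_eval (U : unitRingType) (s : int) (ks : seq int) (a b : U) : U :=
  if ks is k :: ks' then b ^ s * a ^ k * alt_eval (- s) ks' a b else b ^ s.

Definition word_eval (U : unitRingType) (w : good_word) (a b : U) : U :=
  alt_eval (gw_s1 w) (gw_exps w) a b.

(** Index 0 is the variable [x], index 1 the variable [z]. *)

Notation poly2 R := {mpoly (R[i])[2]}.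

Definition var_x (R : realType) : poly2 R := 'X_(0 : 'I_2).
Definition var_z (R : realType) : poly2 R := 'X_(1 : 'I_2).

Definition eval2 (R : realType) (p : poly2 R) (x z : R[i]) : R[i] :=
  p.@[fun j : 'I_2 => if j == 0 then x else z].

Definition int_coeff_poly (R : realType) (p : poly2 R) : Prop :=
  exists q : {mpoly int[2]}, p = map_mpoly intr q.

(* Main.v *)
From HB Require Import structures.
Require Import Defs.
From mathcomp Require Import all_boot all_order all_algebra.
From mathcomp Require Import reals complex mpoly.
From mathcomp Require Import ring zify.
Import GRing.Theory Num.Theory.
Local Open Scope ring_scope.
Local Open Scope complex_scope.

(** A balanced regular word in [A] and [B] is an alternating word
    [C^(r_1) A^(r_2) C^(r_3) ...] in [C = B A B^-1] and [A], two elements of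
    [SL_2] with the same trace [t].  Write [x = t^2 - 4] and
    [z = tr(A C^-1) - 2 = tr(A B A^-1 B^-1) - 2].  By Cayley-Hamilton,
    [A^-1 = t - A], [C^-1 = t - C] and [A C + C A = t A + t C - (z + 2)], so
    every word in [A] and [C] is a combination of [1, A, C, C A] with
    coefficients in [Z[t, z]], independent of the matrices.

    These relations are homogeneous for the parity that makes [t], [A] and
    [C] odd and [z] even.  Hence a word with even exponent sum is
      [p0 + p1 (t A) + p2 (t C) + p3 (C A)]
    with [p0, ..., p3] in [Z[t^2, z] = Z[x, z]]
    ([regular_balanced_even_comb]).

    All three matrix formulas and the trace formula are linear in
    [(r, s, t, om, g)] over [Z[x, z]], so it is enough to read these five
    polynomials off the four matrices [1], [t A], [t C], [C A]:
      [1]   gives [(1, 0, 0, 0, 0)],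
      [t A] gives [((x + 4)/2, x/2, 0, 0, 1/2)],
      [t C] gives [((x + 4)/2, x/2 - z, 0, -1, 1/2)],
      [C A] gives [((x + 2 - z)/2, (x - z)/2, 1/2, -1/2, 1/2)].
    Each row satisfies [x g = s - z om], has half-integral entries, and has
    [r - s] and [t - om] integral; [poly_r], ..., [poly_g] are the resulting
    combinations, and [comb_diagonal], [comb_parabolic],
    [comb_common_fixpoint] and [trace_comb] check the rows against the
    canonical matrices and the trace.  Finally [r(0, 0) = 1] is the trace
    formula at [A = B = 1]; in the parabolic case with [z = 0] it is what
    makes the diagonal entries equal to [1]. *)

Set Implicit Arguments.
Unset Strict Implicit.

Local Notation X := (@mpolyX 2 int U_(0)).
Local Notation Z := (@mpolyX 2 int U_(1)).

(** * Quaternion-like algebras generated by two elements of equal trace *)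

(** The relations that Cayley-Hamilton imposes on [A], [C] in [SL_2] with
    [tr A = tr C = t] and [tr (A C^-1) = z + 2]. *)
Record sl2_like (K : comNzRingType) (U : unitAlgType K) (t z : K) (A C : U) :
    Prop := Sl2Like {
  sl_unitA : A \is a GRing.unit;
  sl_unitC : C \is a GRing.unit;
  sl_invA : A^-1 = t%:A - A;
  sl_invC : C^-1 = t%:A - C;
  sl_comm : A * C = t *: A + t *: C - C * A - (z + 2)%:A }.

Section Comb.
Variables (K : comNzRingType) (U : unitAlgType K).
Implicit Types A C : U.

Definition comb A C (p0 p1 p2 p3 : K) : U :=
  p0%:A + p1 *: A + p2 *: C + p3 *: (C * A).

Lemma combD A C p0 p1 p2 p3 q0 q1 q2 q3 :
  comb A C p0 p1 p2 p3 + comb A C q0 q1 q2 q3 =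
  comb A C (p0 + q0) (p1 + q1) (p2 + q2) (p3 + q3).
Proof.
by rewrite /comb !scalerDl addrACA [X in X + _]addrACA [X in X + _ + _]addrACA.
Qed.

Lemma combZ A C k p0 p1 p2 p3 :
  k *: comb A C p0 p1 p2 p3 = comb A C (k * p0) (k * p1) (k * p2) (k * p3).
Proof. by rewrite /comb !scalerDr !scalerA. Qed.

Lemma sqr_quadratic (t : K) A :
  A \is a GRing.unit -> A^-1 = t%:A - A -> A * A = t *: A - 1.
Proof.
move=> uA iA; rewrite -(divrr uA) iA mulrBr -scalerAr mulr1.
by rewrite opprB addrCA subrr addr0.
Qed.

Variables (t z : K) (A C : U).
Hypothesis hAC : sl2_like t z A C.
Local Notation cb := (comb A C).

Lemma comb_1 : 1 = cb 1 0 0 0.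
Proof. by rewrite /comb !scale0r !addr0 scale1r. Qed.
Lemma comb_A : A = cb 0 1 0 0.
Proof. by rewrite /comb !scale0r !addr0 scale1r add0r. Qed.
Lemma comb_C : C = cb 0 0 1 0.
Proof. by rewrite /comb !scale0r !addr0 scale1r !add0r. Qed.
Lemma comb_CA : C * A = cb 0 0 0 1.
Proof. by rewrite /comb !scale0r scale1r !add0r. Qed.
Lemma comb_AA : A * A = cb (-1) t 0 0.
Proof.
rewrite (sqr_quadratic (sl_unitA hAC) (sl_invA hAC)).
by rewrite /comb !scale0r !addr0 scaleN1r addrC.
Qed.
Lemma comb_CC : C * C = cb (-1) 0 t 0.
Proof.
rewrite (sqr_quadratic (sl_unitC hAC) (sl_invC hAC)).
by rewrite /comb !scale0r !addr0 scaleN1r addrC.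
Qed.
Lemma comb_AC : A * C = cb (- (z + 2)) t t (-1).
Proof.
rewrite (sl_comm hAC) /comb scaleNr scaleN1r addrC -!addrA; congr (_ + _).
Qed.
Lemma comb_CCA : C * (C * A) = cb 0 (-1) 0 t.
Proof.
rewrite mulrA comb_CC /comb !scale0r !addr0 mulrDl -!scalerAl mul1r.
by rewrite add0r.
Qed.
Lemma comb_mulC p0 p1 p2 p3 :
  C * cb p0 p1 p2 p3 = cb (- p2) (- p3) (p0 + t * p2) (p1 + t * p3).
Proof.
rewrite {1}/comb !mulrDr -!scalerAr mulr1 comb_CCA comb_CC comb_CA {1}comb_C.
by rewrite !combZ !combD; congr comb; ring.
Qed.
Lemma comb_ACA : A * (C * A) = cb (- t) (t ^+ 2 - z - 2) 1 0.
Proof.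
rewrite mulrA comb_AC {1}/comb !mulrDl -!scalerAl mul1r -mulrA comb_AA.
by rewrite comb_mulC {1}comb_A comb_CA !combZ !combD; congr comb; ring.
Qed.

Lemma comb_mulA p0 p1 p2 p3 :
  A * cb p0 p1 p2 p3 =
  cb (- p1 - (z + 2) * p2 - t * p3) (p0 + t * p1 + t * p2 + (t ^+ 2 - z - 2) * p3)
     (t * p2 + p3) (- p2).
Proof.
rewrite {1}/comb !mulrDr -!scalerAr mulr1 comb_ACA comb_AC comb_AA {1}comb_A.
by rewrite !combZ !combD; congr comb; ring.
Qed.

End Comb.

(** * Parity of words *)

Definition int_eval (K : comNzRingType) (x z : K) (p : {mpoly int[2]}) : K :=
  (map_mpoly intr p).@[fun j : 'I_2 => if j == 0 then x else z].

HB.instance Definition _ (K : comNzRingType) (x z : K) :=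
  GRing.RMorphism.copy (int_eval x z)
    (meval (fun j : 'I_2 => if j == 0 then x else z) \o map_mpoly intr).

Lemma int_evalE (K : comNzRingType) (x z : K) (ev := int_eval x z) :
  {morph ev : p q / p + q} * {morph ev : p / - p} * {morph ev : p q / p * q} *
  (ev X = x) * (ev Z = z) * (ev 1 = 1) * (ev 0 = 0).
Proof.
by do !split; [exact: rmorphD | exact: rmorphN | exact: rmorphM |
  rewrite /ev /int_eval map_mpolyX mevalXU.. | exact: rmorph1 | exact: rmorph0].
Qed.

Inductive coefs := Coefs of {mpoly int[2]} & {mpoly int[2]}
                          & {mpoly int[2]} & {mpoly int[2]}.

(** Combinations that are homogeneous of parity [o] when [t], [A], [C] are
    odd: each power of [t] in front of a coefficient compensates the parity
    of the basis element, and the rest is a polynomial in [t ^+ 2]. *)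
Definition pcomb (K : comNzRingType) (U : unitAlgType K) (o : bool) (p : coefs)
    (t z : K) (A C : U) : U :=
  let ev := int_eval (t ^+ 2 - 4) z in let: Coefs p0 p1 p2 p3 := p in
  comb A C (t ^+ o * ev p0) (t ^+ (~~ o) * ev p1)
           (t ^+ (~~ o) * ev p2) (t ^+ o * ev p3).

(** The new coefficients [q] are chosen before the algebra and its elements:
    this uniformity is what lets one tuple of polynomials serve all pairs
    of isometries. *)
Definition graded (d : bool)
    (F : forall (K : comNzRingType) (U : unitAlgType K), K -> U -> U -> U) :=
  forall o p, exists q,
    forall (K : comNzRingType) (U : unitAlgType K) (t z : K) (A C : U),
    sl2_like t z A C ->
    F K U t A C * pcomb o p t z A C = pcomb (d (+) o) q t z A C.

Lemma graded_trace : graded true (fun K U t A C => t%:A).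
Proof.
move=> o [p0 p1 p2 p3].
(* [t * t ^+ b] is [t ^+ ~~ b] times [w b], as [t ^+ 2 = x + 4]. *)
pose w b := if b then X + 4 else 1.
exists (Coefs (w o * p0) (w (~~ o) * p1) (w (~~ o) * p2) (w o * p3)).
move=> K U t z A C hAC; rewrite /pcomb -scalerAl mul1r combZ.
case: o; rewrite /w /= !int_evalE; move: (int_eval _ _) => ev;
  move: (ev p0) (ev p1) (ev p2) (ev p3) => e0 e1 e2 e3; congr comb; ring.
Qed.

Lemma graded_A : graded true (fun K U t A C => A).
Proof.
move=> o [p0 p1 p2 p3].
pose w b := if b then X + 4 else 1.
exists (Coefs (- p1 - (Z + 2) * p2 - w o * p3)
              (p0 + w (~~ o) * (p1 + p2) + (X + 2 - Z) * p3)
              (w (~~ o) * p2 + p3) (- p2)).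
move=> K U t z A C hAC; rewrite /pcomb (comb_mulA hAC).
case: o; rewrite /w /= !int_evalE; move: (int_eval _ _) => ev;
  move: (ev p0) (ev p1) (ev p2) (ev p3) => e0 e1 e2 e3; congr comb; ring.
Qed.

Lemma graded_C : graded true (fun K U t A C => C).
Proof.
move=> o [p0 p1 p2 p3].
pose w b := if b then X + 4 else 1.
exists (Coefs (- p2) (- p3) (p0 + w (~~ o) * p2) (p1 + w o * p3)).
move=> K U t z A C hAC; rewrite /pcomb (comb_mulC hAC).
case: o; rewrite /w /= !int_evalE; move: (int_eval _ _) => ev;
  move: (ev p0) (ev p1) (ev p2) (ev p3) => e0 e1 e2 e3; congr comb; ring.
Qed.

Lemma graded_1 : graded false (fun K U t A C => 1).
Proof. by move=> o p; exists p => K U t z A C _; rewrite mul1r. Qed.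

Lemma graded_mul d d' F G : graded d F -> graded d' G ->
  graded (d (+) d') (fun K U t A C => F K U t A C * G K U t A C).
Proof.
move=> gF gG o p; have [q Gq] := gG o p; have [q' Fq'] := gF (d' (+) o) q.
exists q' => K U t z A C hAC.
by rewrite -mulrA (Gq _ _ _ _ _ _ hAC) (Fq' _ _ _ _ _ _ hAC) addbA.
Qed.

Lemma graded_sub d F G : graded d F -> graded d G ->
  graded d (fun K U t A C => F K U t A C - G K U t A C).
Proof.
move=> gF gG o p; have [[f0 f1 f2 f3] Fp] := gF o p.
have [[g0 g1 g2 g3] Gp] := gG o p.
exists (Coefs (f0 - g0) (f1 - g1) (f2 - g2) (f3 - g3)) => K U t z A C hAC.
rewrite mulrBl (Gp _ _ _ _ _ _ hAC) (Fp _ _ _ _ _ _ hAC) /pcomb -scaleN1r.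
rewrite combZ combD !int_evalE; move: (int_eval _ _) => ev.
by rewrite !mulrBr !mulN1r.
Qed.

Lemma graded_eq d F G :
  (forall (K : comNzRingType) (U : unitAlgType K) (t z : K) (A C : U), sl2_like t z A C ->
     F K U t A C = G K U t A C) ->
  graded d F -> graded d G.
Proof.
move=> FG gF o p; have [q Fq] := gF o p; exists q => K U t z A C hAC.
by rewrite -(FG _ _ _ _ _ _ hAC) (Fq _ _ _ _ _ _ hAC).
Qed.

Lemma graded_expz d F (k : int) :
  graded d F -> graded d (fun K U t A C => (F K U t A C)^-1) ->
  graded (odd `|k|%N && d) (fun K U t A C => F K U t A C ^ k).
Proof.
have graded_exp G n : graded d G ->
    graded (odd n && d) (fun K U t A C => G K U t A C ^+ n).
  move=> gG; elim: n => [|n IHn].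
    by apply: graded_eq graded_1 => K U t z A C _; rewrite expr0.
  have -> : odd n.+1 && d = d (+) (odd n && d).
    by rewrite oddS; case: (odd n); case: {+}d.
  by apply: graded_eq (graded_mul gG IHn) => K U t z A C _; rewrite exprS.
case: k => n gF gF'; first exact: graded_exp gF.
by apply: graded_eq (graded_exp _ n.+1 gF') => K U t z A C _; rewrite exprVn.
Qed.

(** [A^-1 = t - A] has the same parity as [A]. *)
Lemma graded_expA (k : int) : graded (odd `|k|%N) (fun K U t A C => A ^ k).
Proof.
rewrite -[odd _]andbT; apply: graded_expz graded_A _.
by apply: graded_eq (graded_sub graded_trace graded_A) => K U t z A C [].
Qed.

Lemma graded_expC (k : int) : graded (odd `|k|%N) (fun K U t A C => C ^ k).
Proof.
rewrite -[odd _]andbT; apply: graded_expz graded_C _.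
by apply: graded_eq (graded_sub graded_trace graded_C) => K U t z A C [].
Qed.

(** * Alternating words *)

Fixpoint alternating (U : unitRingType) (ks : seq int) (c a : U) : U :=
  if ks is k :: ks' then c ^ k * alternating ks' a c else 1.

Lemma graded_alternating ks : let d := odd (\sum_(k <- ks) `|k|%N) in
  graded d (fun K U t A C => alternating ks C A) /\
  graded d (fun K U t A C => alternating ks A C).
Proof.
elim: ks => [|k ks [IHC IHA]] /=; first by rewrite big_nil; split; exact: graded_1.
by rewrite big_cons oddD; split;
  [exact: graded_mul (graded_expC k) IHA | exact: graded_mul (graded_expA k) IHC].
Qed.

Lemma expz_conj (U : unitRingType) (a b : U) (k : int) :
  b \is a GRing.unit -> a \is a GRing.unit ->
  (b * a * b^-1) ^ k = b * a ^ k * b^-1.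
Proof.
move=> ub ua; have pow (u : U) n : (b * u * b^-1) ^+ n = b * u ^+ n * b^-1.
  elim: n => [|n IHn]; first by rewrite !expr0 mulr1 divrr.
  by rewrite !exprS IHn -!mulrA (mulKr ub).
have inv : (b * a * b^-1)^-1 = b * a^-1 * b^-1.
  by rewrite invrM ?unitrMl ?unitrV // invrM // invrK mulrA.
case: k => n; first exact: pow.
by rewrite /exprz -!exprVn inv pow.
Qed.

(** Each block [b a^k b^-1] is [c ^ k]; a word that starts at [b^-1] keeps
    this factor in front, so both starting signs are needed at once in the
    induction. *)
Lemma alt_eval_conj (U : unitRingType) (a b : U) (ks : seq int) :
  a \is a GRing.unit -> b \is a GRing.unit ->
  let c := b * a * b^-1 in
  alt_eval (if odd (size ks) then 1 else -1) ks a b =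
  if odd (size ks) then alternating ks c a else b^-1 * alternating ks a c.
Proof.
move=> ua ub c; elim: ks => [|k ks IHks] /=; first by rewrite mulr1.
case: (odd (size ks)) IHks => /= IHks; rewrite ?opprK IHks.
  by rewrite -mulrA.
by rewrite expr1z /c expz_conj // !mulrA.
Qed.

Lemma even_sum_absz ks :
  (2 %| \sum_(k <- ks) k)%Z = ~~ odd (\sum_(k <- ks) `|k|%N).
Proof.
elim: ks => [|k ks IHks]; first by rewrite !big_nil.
rewrite !big_cons.
by move: (\sum_(j <- ks) j) (\sum_(j <- ks) `|j|%N)%N IHks => s n; lia.
Qed.

(** The word is the product of a graded alternating word by [1], which has
    coefficients [1, 0, 0, 0] and parity [false]. *)
Lemma regular_balanced_even_comb (w : good_word) :
  regular_word w -> balanced_word w -> even_word w ->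
  exists p0 p1 p2 p3 : {mpoly int[2]},
  forall (K : comNzRingType) (U : unitAlgType K) (t z : K) (A B : U),
    B \is a GRing.unit -> sl2_like t z A (B * A * B^-1) ->
    let ev := int_eval (t ^+ 2 - 4) z in
    word_eval w A B = comb A (B * A * B^-1) (ev p0) (t * ev p1) (t * ev p2) (ev p3).
Proof.
case: w => [[] ks] //; rewrite /balanced_word /even_word /gw_m /= => _.
rewrite negbK => sz_ks ev_ks.
have [[p0 p1 p2 p3] alt_p] :=
  (graded_alternating ks).1 false (Coefs 1 0 0 0).
exists p0, p1, p2, p3 => K U t z A B uB hAC /=.
have := alt_p _ _ _ _ _ _ hAC.
have -> : odd (\sum_(k <- ks) `|k|%N) (+) false = false.
  by move: ev_ks; rewrite even_sum_absz => /negbTE->.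
rewrite /pcomb !int_evalE /= expr0 expr1 !mul1r mulr0 -comb_1 mulr1 => <-.
rewrite /word_eval /gw_s1 /= expr0.
by have := alt_eval_conj ks (sl_unitA hAC) uB; rewrite sz_ks.
Qed.

(** * Matrices of size two *)

Section Matrix22.
Variable K : comUnitRingType.
Implicit Types A B C M : 'M[K]_2.

Lemma mx22_eta M : M = mx22 (M 0 0) (M 0 1) (M 1 0) (M 1 1).
Proof.
by apply/matrixP=> [[[|[|//]] lti] [[|[|//]] ltj]]; rewrite mxE /=;
  congr (M _ _); apply: val_inj.
Qed.

Lemma mx22M (a b c d a' b' c' d' : K) :
  mx22 a b c d * mx22 a' b' c' d' =
  mx22 (a * a' + b * c') (a * b' + b * d') (c * a' + d * c') (c * b' + d * d').
Proof. by rewrite [LHS]mx22_eta !mxE !big_ord_recl !big_ord0 !mxE /= !addr0. Qed.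

Lemma mx22D (a b c d a' b' c' d' : K) :
  mx22 a b c d + mx22 a' b' c' d' = mx22 (a + a') (b + b') (c + c') (d + d').
Proof. by rewrite [LHS]mx22_eta !mxE. Qed.

Lemma mx22Z (k a b c d : K) :
  k *: mx22 a b c d = mx22 (k * a) (k * b) (k * c) (k * d).
Proof. by rewrite [LHS]mx22_eta !mxE. Qed.

Lemma mx22_1 : 1 = mx22 1 0 0 1 :> 'M[K]_2.
Proof. by rewrite [LHS]mx22_eta !mxE. Qed.

Lemma mx22_tr (a b c d : K) : \tr (mx22 a b c d) = a + d.
Proof. by rewrite /mxtrace !big_ord_recl big_ord0 !mxE /= addr0. Qed.

Lemma mx22_det (a b c d : K) : \det (mx22 a b c d) = a * d - b * c.
Proof.
rewrite (expand_det_row _ ord0) !big_ord_recl big_ord0 /cofactor !det_mx11 !mxE.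
by rewrite /= expr0 expr1 mul1r mulN1r mulrN addr0.
Qed.

Lemma unit_det1 M : \det M = 1 -> M \is a GRing.unit.
Proof. by move=> dM; change (M \in unitmx); rewrite unitmxE dM unitr1. Qed.

Lemma inv_det1 M : \det M = 1 -> M^-1 = (\tr M)%:A - M.
Proof.
move=> dM; apply: (mulrI (unit_det1 dM)); rewrite divrr ?unit_det1 //.
move: dM; rewrite [M]mx22_eta mx22_det mx22_tr -scaleN1r mx22_1 !(mx22Z, mx22D, mx22M) => dM.
by congr mx22; rewrite -?[LHS]dM; ring.
Qed.

Lemma inv_mx22 (a b c d : K) : a * d - b * c = 1 ->
  (mx22 a b c d)^-1 = mx22 d (- b) (- c) a.
Proof.
move=> dM; rewrite inv_det1 ?mx22_det // mx22_tr -scaleN1r mx22_1 !(mx22Z, mx22D).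
by congr mx22; ring.
Qed.

(** The third relation is Cayley-Hamilton for [A C^-1], whose inverse is
    [C A^-1] and whose trace is that of the commutator of [A] and [B]. *)
Lemma SL2_sl2_like A B : \det A = 1 -> \det B = 1 ->
  sl2_like (\tr A) (\tr (A * B * A^-1 * B^-1) - 2) A (B * A * B^-1).
Proof.
move=> dA dB; have [uA uB] := (unit_det1 dA, unit_det1 dB).
set C := B * A * B^-1.
have dC : \det C = 1 by rewrite !detM dA mulr1 -detM divrr // det1.
have trC : \tr C = \tr A.
  by rewrite /C mxtrace_mulC mulmxA -[_ *m B]/(_ * _) mulVr // mul1mx.
have iC : C^-1 = (\tr A)%:A - C by rewrite inv_det1 // trC.
have uC := unit_det1 dC.
split=> //; first exact: inv_det1.
have dN : \det (A * C^-1) = 1 by rewrite detM dA mul1r detV dC invr1.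
have := inv_det1 dN.
have -> : A * B * A^-1 * B^-1 = A * C^-1.
  by rewrite /C invrM ?unitrV ?unitrMl // invrK invrM // !mulrA.
rewrite subrK invrM ?unitrV // invrK (inv_det1 dA) iC.
rewrite !mulrBr -!scalerAr !mulr1; set g := (\tr _)%:A => E.
by rewrite -[A * C](subKr (\tr A *: A)) -[\tr A *: A - A * C](subKr g) -E opprB !addrA.
Qed.
End Matrix22.

(** * The five polynomials *)

Section Polys.
Variable P : comNzRingType.
Implicit Types x z h : P.

(** In these definitions [h] stands for [1/2] and [q0, ..., q3] are the
    coefficients of the word on [1], [t A], [t C], [C A]. *)
Definition poly_r x z h (q0 q1 q2 q3 : P) :=
  q0 + h * ((x + 4) * (q1 + q2) + (x + 2 - z) * q3).
Definition poly_s x z h (q1 q2 q3 : P) := h * (x * (q1 + q2) + (x - z) * q3) - z * q2.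
Definition poly_t h (q3 : P) := h * q3.
Definition poly_om h (q2 q3 : P) := - q2 - h * q3.
Definition poly_g h (q1 q2 q3 : P) := h * (q1 + q2 + q3).

Lemma half2 h (q : P) : h *+ 2 = 1 -> (h * q) *+ 2 = q.
Proof. by move=> h2; rewrite -mulrnAl h2 mul1r. Qed.
Lemma poly_gE x z h (q1 q2 q3 : P) :
  x * poly_g h q1 q2 q3 = poly_s x z h q1 q2 q3 - z * poly_om h q2 q3.
Proof. by rewrite /poly_g /poly_s /poly_om; ring. Qed.
End Polys.

(** * Evaluation on canonical pairs *)

Section CanonicalForms.
Variable K : fieldType.
Hypothesis nz2 : 2 != 0 :> K.
Local Notation h := (2^-1 : K).

Lemma comb_scaled (U : unitAlgType K) (t p0 p1 p2 p3 : K) (A C : U) :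
  comb A C p0 (t * p1) (t * p2) p3 =
  p0%:A + p1 *: (t *: A) + p2 *: (t *: C) + p3 *: (C * A).
Proof. by rewrite /comb !scalerA ![t * _]mulrC. Qed.

(** Here [u - v] is a square root of [be], [u + v] is the trace of [A] and
    [Q = u^2 - v^2] a square root of [be (be + 4)].  With [v = u^-1] and the
    products [a d], [b c] eliminated, every entry becomes an identity of
    rational functions in [u]. *)
Lemma comb_diagonal (u v a b c d ga p0 p1 p2 p3 : K) :
  u * v = 1 -> u - v != 0 ->
  let be := (u - v) ^+ 2 in let Q := (u + v) * (u - v) in
  a * d = 1 - ga / be -> b * c = - (ga / be) ->
  let A := mx22 u 0 0 v in let B := mx22 a b c d in
  let r := poly_r be ga h p0 p1 p2 p3 in let s := poly_s be ga h p1 p2 p3 in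
  comb A (B * A * mx22 d (- b) (- c) a) p0 ((u + v) * p1) ((u + v) * p2) p3 =
  mx22 (r + s * Q / be)
       (a * b * (be * poly_t h p3 + poly_om h p2 p3 * Q))
       (c * d * (be * poly_t h p3 - poly_om h p2 p3 * Q))
       (r - s * Q / be).
Proof.
move=> uv nz be Q ad bc A B r s.
have nzu : u != 0 by apply: contra_eq_neq uv => ->; rewrite mul0r eq_sym oner_neq0.
have vE : v = u^-1 by rewrite -[LHS](mulKf nzu) uv mulr1.
have nzu2 : u ^+ 2 - 1 != 0.
  have -> : u ^+ 2 - 1 = u * (u - v) by rewrite vE; field.
  exact: mulf_neq0.
have -> : B * A * mx22 d (- b) (- c) a =
    mx22 (a * d * u - b * c * v) (a * b * (v - u)) (c * d * (u - v)) (a * d * v - b * c * u).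
  by rewrite !mx22M; congr mx22; ring.
rewrite comb_scaled mx22_1 !(mx22Z, mx22M, mx22D) ad bc /r /s /Q /be.
rewrite /poly_r /poly_s /poly_t /poly_om vE.
by congr mx22; field; rewrite ?nzu ?nz2 -?expr2 ?nzu2.
Qed.

Lemma comb_parabolic (ga c d p0 p1 p2 p3 : K) : c != 0 -> ga = c ^+ 2 ->
  let A := mx22 1 1 0 1 in let B := mx22 0 (- c^-1) c d in
  comb A (B * A * mx22 d c^-1 (- c) 0) p0 (2 * p1) (2 * p2) p3 =
  mx22 (poly_r 0 ga h p0 p1 p2 p3 + ga * poly_t h p3)
       (4 * poly_g h p1 p2 p3 + 2 * poly_om h p2 p3)
       (2 * ga * poly_om h p2 p3)
       (poly_r 0 ga h p0 p1 p2 p3 - ga * poly_t h p3).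
Proof.
move=> nzc -> A B; rewrite comb_scaled mx22_1 !(mx22Z, mx22M, mx22D).
rewrite /poly_r /poly_g /poly_t /poly_om.
by congr mx22; field; rewrite ?nzc ?nz2.
Qed.

(** Both matrices are upper triangular, so the diagonal of the combination
    does not depend on [A] and [B]; it is [r(0, 0)]. *)
Lemma comb_common_fixpoint (a a' l p0 p1 p2 p3 : K) : a * a' = 1 ->
  poly_r 0 0 h p0 p1 p2 p3 = 1 ->
  let A := mx22 1 1 0 1 in let B := mx22 a l 0 a' in
  comb A (B * A * mx22 a' (- l) 0 a) p0 (2 * p1) (2 * p2) p3 =
  mx22 1 (4 * poly_g h p1 p2 p3 - (2 * a ^+ 2 - 2) * poly_om h p2 p3) 0 1.
Proof.
move=> aa' r1 A B.
have -> : B * A * mx22 a' (- l) 0 a = mx22 (a * a') (a ^+ 2) 0 (a * a').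
  by rewrite !mx22M; congr mx22; ring.
rewrite aa' comb_scaled mx22_1 !(mx22Z, mx22M, mx22D).
rewrite /poly_g /poly_om.
by congr mx22; rewrite -?[RHS]r1 /poly_r; field; rewrite ?nz2.
Qed.

(** Taking traces in [A C + C A = t A + t C - (z + 2)] gives
    [tr (C A) = x + 2 - z]. *)
Lemma trace_comb (A B : 'M[K]_2) (p0 p1 p2 p3 : K) :
  \det A = 1 -> \det B = 1 ->
  let t := \tr A in let ga := \tr (A * B * A^-1 * B^-1) - 2 in
  \tr (comb A (B * A * B^-1) p0 (t * p1) (t * p2) p3) =
  2 * poly_r (t ^+ 2 - 4) ga h p0 p1 p2 p3.
Proof.
move=> dA dB t ga; have hAC := SL2_sl2_like dA dB.
set C := B * A * B^-1 in hAC *.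
have trC : \tr C = t.
  by rewrite /C mxtrace_mulC mulmxA -[_ *m B]/(_ * _) mulVr ?unit_det1 // mul1mx.
rewrite -/ga in hAC *; clearbody ga C.
have tr1 : \tr (1 : 'M[K]_2) = 2 by rewrite mxtrace1.
have trCA : \tr (C * A) = t ^+ 2 - ga - 2.
  have /(congr1 mxtrace) := sl_comm hAC.
  rewrite [\tr (A * C)]mxtrace_mulC !raddfB !raddfD /= !mxtraceZ trC tr1 -/t.
  rewrite -[C *m A]/(C * A) => E; apply: (mulfI nz2).
  by rewrite mulr_natl mulr2n {1}E; ring.
rewrite comb_scaled !raddfD /= !mxtraceZ trC trCA tr1 -/t /poly_r.
by field; rewrite ?nz2.
Qed.
End CanonicalForms.

(** * Integrality *)

Section Polynomials.
Variable R : realType.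
Local Notation K := (R[i]).
Implicit Types p q : {mpoly K[2]}.

Lemma eval2E (x z : K) (ev := fun p => eval2 p x z) :
  {morph ev : p q / p + q} * {morph ev : p / - p} * {morph ev : p q / p * q} *
  (ev (var_x R) = x) * (ev (var_z R) = z) * (forall c, ev c%:MP = c) *
  (forall n, ev n%:R = n%:R).
Proof.
do !split; rewrite /ev /eval2.
- exact: rmorphD.
- exact: rmorphN.
- exact: rmorphM.
- by rewrite mevalXU.
- by rewrite mevalXU.
- exact: mevalC.
- exact: rmorph_nat.
Qed.

Lemma int_coeffD p q :
  int_coeff_poly p -> int_coeff_poly q -> int_coeff_poly (p + q).
Proof. by move=> [p' ->] [q' ->]; exists (p' + q'); rewrite rmorphD. Qed.

Lemma int_coeffN p : int_coeff_poly p -> int_coeff_poly (- p).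
Proof. by move=> [p' ->]; exists (- p'); rewrite rmorphN. Qed.

Lemma int_coeffM p q :
  int_coeff_poly p -> int_coeff_poly q -> int_coeff_poly (p * q).
Proof. by move=> [p' ->] [q' ->]; exists (p' * q'); rewrite rmorphM. Qed.

Lemma int_coeff_nat n : int_coeff_poly (n%:R : {mpoly K[2]}).
Proof. by exists n%:R; rewrite rmorph_nat. Qed.

Lemma int_coeff_x : int_coeff_poly (var_x R).
Proof. by exists X; rewrite map_mpolyX. Qed.

Lemma int_coeff_z : int_coeff_poly (var_z R).
Proof. by exists Z; rewrite map_mpolyX. Qed.
End Polynomials.

(** Stated for any predicate [I] closed under the ring operations, so that the
    identities are proved over an abstract ring. *)
Section Integrality.
Variables (P : comNzRingType) (I : P -> Prop).
Hypotheses (ID : forall p q, I p -> I q -> I (p + q)) (IN : forall p, I p -> I (- p))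
  (IM : forall p q, I p -> I q -> I (p * q)) (In : forall n, I n%:R).
Variables x z h q0 q1 q2 q3 : P.
Hypotheses (Ix : I x) (Iz : I z) (h2 : h *+ 2 = 1).
Hypotheses (I0 : I q0) (I1 : I q1) (I2 : I q2) (I3 : I q3).
Let IMn n p : I p -> I (p *+ n). Proof. by move=> Ip; rewrite -mulr_natr; apply: IM. Qed.

Lemma poly_integral :
  [/\ I (poly_r x z h q0 q1 q2 q3 *+ 2), I (poly_s x z h q1 q2 q3 *+ 2),
      I (poly_t h q3 *+ 2) & I (poly_om h q2 q3 *+ 2)] /\
  I (poly_r x z h q0 q1 q2 q3 - poly_s x z h q1 q2 q3) /\
  I (poly_t h q3 - poly_om h q2 q3).
Proof.
have hh q : h * q + h * q = q by rewrite -mulr2n half2.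
rewrite /poly_r /poly_s /poly_t /poly_om; do !split.
- by rewrite mulrnDl half2 //;
    do ?[done | exact: In | apply: IN | apply: ID | apply: IM | apply: IMn].
- by rewrite mulrnBl half2 //;
    do ?[done | exact: In | apply: IN | apply: ID | apply: IM | apply: IMn].
- by rewrite half2.
- by rewrite mulrnBl half2 //;
    do ?[done | exact: In | apply: IN | apply: ID | apply: IM | apply: IMn].
- have -> : q0 + h * ((x + 4) * (q1 + q2) + (x + 2 - z) * q3) -
    (h * (x * (q1 + q2) + (x - z) * q3) - z * q2) =
    q0 + h *+ 2 * (2 * (q1 + q2) + q3) + z * q2 by ring.
  by rewrite h2 mul1r; do ?[done | exact: In | apply: IN | apply: ID | apply: IM | apply: IMn].
- by rewrite opprB opprK addrA hh; apply: ID.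
Qed.
End Integrality.

(** * The theorem *)

Lemma alt_eval_1 (U : unitRingType) (s : int) ks : alt_eval s ks 1 1 = 1 :> U.
Proof. by elim: ks s => [|k ks IHks] s; rewrite /= ?IHks !exp1rz ?mulr1. Qed.

Lemma represents_det1 (R : realType) (f : PSL2 R) M : represents f M -> \det M = 1.
Proof. by case=> [[M' dM]] <- _; apply/eqP. Qed.

Lemma trace_diagonal_commutator (K : comUnitRingType) (u v a b c d : K) :
  u * v = 1 -> a * d - b * c = 1 ->
  \tr (mx22 u 0 0 v * mx22 a b c d * mx22 v 0 0 u * mx22 d (- b) (- c) a) =
  2 - b * c * (u - v) ^+ 2.
Proof.
move=> uv dB; rewrite !mx22M mx22_tr.
transitivity (2 * (a * d) * (u * v) - b * c * (u ^+ 2 + v ^+ 2)); first by ring.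
have -> : (u - v) ^+ 2 = u ^+ 2 + v ^+ 2 - 2 * (u * v) by ring.
by rewrite uv -[a * d](subrK (b * c)) dB; ring.
Qed.

Unset Implicit Arguments.

Theorem theorem5p2 (R : realType) (w : good_word) :
  regular_word w -> balanced_word w -> even_word w ->
  exists r s t om gp : {mpoly (R[i])[2]},
    [/\ int_coeff_poly (r *+ 2), int_coeff_poly (s *+ 2),
        int_coeff_poly (t *+ 2) & int_coeff_poly (om *+ 2)] /\
    [/\ int_coeff_poly (r - s), int_coeff_poly (t - om),
        eval2 r 0 0 = 1 & var_x R * gp = s - var_z R * om] /\
    forall f g : PSL2 R, f <> PSL2_one R -> g <> PSL2_one R ->
      let be := beta f in let be' := beta g in let ga := gamma f g in
      (forall A B : 'M[R[i]]_2,
        canonical_pair be be' ga A B -> represents_up_to_conj f g A B ->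
        [/\ be != 0 ->
            let Q := sqrtc (be * (be + 4)) in
            let a := B 0 0 in let b := B 0 1 in
            let c := B 1 0 in let d := B 1 1 in
            word_eval w A B =
              mx22 (eval2 r be ga + eval2 s be ga * Q / be)
                   (a * b * (be * eval2 t be ga + eval2 om be ga * Q))
                   (c * d * (be * eval2 t be ga - eval2 om be ga * Q))
                   (eval2 r be ga - eval2 s be ga * Q / be),
            be = 0 -> ga != 0 ->
            word_eval w A B =
              mx22 (eval2 r 0 ga + ga * eval2 t 0 ga)
                   (4 * eval2 gp 0 ga + 2 * eval2 om 0 ga)
                   (2 * ga * eval2 om 0 ga)
                   (eval2 r 0 ga - ga * eval2 t 0 ga)
          & be = 0 -> ga = 0 ->
            word_eval w A B =
              mx22 1
                   (4 * eval2 gp 0 0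
                    - (be' + sqrtc be' * sqrtc (be' + 4)) * eval2 om 0 0)
                   0 1]) /\
      (forall F G : 'M[R[i]]_2, represents f F -> represents g G ->
        \tr (word_eval w F G) = 2 * eval2 r be ga).
Proof.
move=> regw balw evw.
have [p0 [p1 [p2 [p3 word_comb]]]] := regular_balanced_even_comb regw balw evw.
set K := R[i]; have nz2 : 2 != 0 :> K by rewrite pnatr_eq0.
pose q p : {mpoly K[2]} := map_mpoly intr p.
pose x := var_x R; pose z := var_z R; pose h : {mpoly K[2]} := (2^-1)%:MP.
pose r := poly_r x z h (q p0) (q p1) (q p2) (q p3).
pose s := poly_s x z h (q p1) (q p2) (q p3).
pose t := poly_t h (q p3); pose om := poly_om h (q p2) (q p3).
pose gp := poly_g h (q p1) (q p2) (q p3).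
have h2 : h *+ 2 = 1 by rewrite -mpolyCMn -[_ *+ 2]mulr_natr mulVf.
have ev_q p be ga : eval2 (q p) be ga = int_eval be ga p by [].
have ev_r be ga : eval2 r be ga = poly_r be ga 2^-1 (int_eval be ga p0)
    (int_eval be ga p1) (int_eval be ga p2) (int_eval be ga p3).
  by rewrite /r /poly_r /h /x /z !eval2E.
have ev_s be ga : eval2 s be ga = poly_s be ga 2^-1
    (int_eval be ga p1) (int_eval be ga p2) (int_eval be ga p3).
  by rewrite /s /poly_s /h /x /z !eval2E.
have ev_t be ga : eval2 t be ga = poly_t 2^-1 (int_eval be ga p3).
  by rewrite /t /poly_t /h !eval2E.
have ev_om be ga : eval2 om be ga =
    poly_om 2^-1 (int_eval be ga p2) (int_eval be ga p3).
  by rewrite /om /poly_om /h !eval2E.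
have ev_gp be ga : eval2 gp be ga = poly_g 2^-1
    (int_eval be ga p1) (int_eval be ga p2) (int_eval be ga p3).
  by rewrite /gp /poly_g /h !eval2E.
have word_SL2 (A B : 'M[K]_2) be ga : \det A = 1 -> \det B = 1 ->
    (\tr A) ^+ 2 - 4 = be -> \tr (A * B * A^-1 * B^-1) - 2 = ga ->
    let ev := int_eval be ga in
    word_eval w A B =
    comb A (B * A * B^-1) (ev p0) (\tr A * ev p1) (\tr A * ev p2) (ev p3).
  move=> dA dB <- <-.
  exact: word_comb (unit_det1 dB) (SL2_sl2_like dA dB).
have tr_word (A B : 'M[K]_2) be ga : \det A = 1 -> \det B = 1 ->
    (\tr A) ^+ 2 - 4 = be -> \tr (A * B * A^-1 * B^-1) - 2 = ga ->
    \tr (word_eval w A B) = 2 * eval2 r be ga.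
  move=> dA dB beE gaE; rewrite (word_SL2 _ _ _ _ dA dB beE gaE) -beE -gaE ev_r.
  exact: trace_comb.
have r00 : eval2 r 0 0 = 1.
  apply: (mulfI nz2); rewrite mulr1 -(tr_word 1 1) ?det1 //.
  - by rewrite /word_eval alt_eval_1 mxtrace1.
  - by rewrite mxtrace1; ring.
  - by rewrite !invr1 !mulr1 mxtrace1; ring.
exists r, s, t, om, gp.
have [ints [int_rs int_tom]] := poly_integral (@int_coeffD R) (@int_coeffN R)
  (@int_coeffM R) (@int_coeff_nat R) (int_coeff_x R) (int_coeff_z R) h2
  (ex_intro _ p0 erefl) (ex_intro _ p1 erefl) (ex_intro _ p2 erefl) (ex_intro _ p3 erefl).
split; first exact: ints.
split.
  by split; [exact: int_rs | exact: int_tom | exact: r00 | exact: poly_gE].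
move=> f g _ _ be be' ga; split; last first.
  move=> F G fF gG; apply: tr_word.
  - exact: represents_det1 fF.
  - exact: represents_det1 gG.
  - by rewrite /be (beta_represents fF).
  - by rewrite /ga (gamma_represents fF gG).
move=> A B canAB _.
clearbody be be' ga; clear h2 ev_q tr_word ints int_rs int_tom.
clearbody r s t om gp.
case: canAB => [[nz_be AE [b [c [bcE BE]]]] | [be0 nz_ga AE BE] | [be0 ga0 AE [l [_ BE]]]].
(* Loxodromic or elliptic [f]: [u] and [v] are the eigenvalues of [A]. *)
- split=> [_ Q a b' c' d'| be0|be0]; [|by rewrite be0 eqxx in nz_be..].
  rewrite ev_r ev_s ev_t ev_om.
  have QQ : Q ^+ 2 = be * (be + 4) := sqr_sqrtc _.
  rewrite {}/a {}/b' {}/c' {}/d' {}BE {}AE /canonA -/Q !mxE /=.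
  set sb := sqrtc be; have sbsb : sb ^+ 2 = be := sqr_sqrtc _.
  have nz_sb : sb != 0 by rewrite -sqrf_eq0 sbsb.
  set u := (Q + be) / _; set v := (Q - be) / _.
  have uv : u * v = 1.
    have -> : u * v = (Q ^+ 2 - be ^+ 2) / (4 * sb ^+ 2) by rewrite /u /v; field.
    by rewrite QQ sbsb; field.
  have u_v : u - v = sb.
    have -> : u - v = be / sb by rewrite /u /v; field.
    by rewrite -sbsb; field.
  have uDv : (u + v) * sb = Q by rewrite /u /v; field.
  set S := sqrtc (be' + 4); set T := sqrtc _; set a := (S + T) / 2; set d := (S - T) / 2.
  have bc : b * c = - (ga / be).
    case: (boolP (ga != 0)) bcE => [_ [-> ->]|].
      by rewrite mulNr -expr2 sqr_sqrtc.
    rewrite negbK => /eqP -> /=; rewrite !inE !xpair_eqE.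
    by case/or3P=> /andP[/eqP-> /eqP->]; rewrite ?(mul0r, mulr0, oppr0).
  have ad : a * d = 1 - ga / be.
    have -> : a * d = (S ^+ 2 - T ^+ 2) / 4 by rewrite /a /d; field.
    by rewrite !sqr_sqrtc; field.
  have dB : a * d - b * c = 1 by rewrite ad bc; ring.
  have dA : u * v - 0 * 0 = 1 by rewrite uv mulr0 subr0.
  have beE : (u - v) ^+ 2 = be by rewrite u_v.
  rewrite (word_SL2 _ _ be ga) ?mx22_det //.
  + rewrite mx22_tr (inv_mx22 dB).
    have := @comb_diagonal _ nz2 u v a b c d ga; rewrite u_v uDv sbsb.
    by apply.
  + rewrite mx22_tr -beE; transitivity ((u - v) ^+ 2 + 4 * (u * v - 1)); first by ring.
    by rewrite uv; ring.
  + rewrite (inv_mx22 dA) (inv_mx22 dB) oppr0 trace_diagonal_commutator // bc beE.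
    by field.
(* Parabolic [f] without a common fixed point. *)
- split=> [nz_be|_ _|_ ga0]; [by rewrite be0 eqxx in nz_be| |by rewrite ga0 eqxx in nz_ga].
  rewrite ev_r ev_t ev_om ev_gp AE BE /unipA mulN1r.
  set c := sqrtc ga; set d := sqrtc _.
  have cc : c ^+ 2 = ga := sqr_sqrtc _.
  have nz_c : c != 0 by rewrite -sqrf_eq0 cc.
  have dA : 1 * 1 - 1 * 0 = 1 :> K by ring.
  have dB : 0 * d - - c^-1 * c = 1 by field.
  have trA : \tr (mx22 1 1 0 1 : 'M[K]_2) = 2 by rewrite mx22_tr.
  rewrite (word_SL2 _ _ 0 ga) ?mx22_det //.
  + by rewrite trA (inv_mx22 dB) opprK; apply: comb_parabolic.
  + by rewrite trA; ring.
  + rewrite (inv_mx22 dA) (inv_mx22 dB) !mx22M mx22_tr -cc; field.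
    exact: nz_c.
(* Parabolic [f] sharing its fixed point with [g]: [2 a^2 - 2] is
   [be' + sqrtc be' * sqrtc (be' + 4)]. *)
- split=> [nz_be|_ nz_ga|_ _]; [by rewrite be0 eqxx in nz_be|by rewrite ga0 eqxx in nz_ga|].
  rewrite ev_om ev_gp AE BE /unipA.
  set S := sqrtc (be' + 4); set T := sqrtc be'; set a := (S + T) / 2; set d := (S - T) / 2.
  have [SS TT] : S ^+ 2 = be' + 4 /\ T ^+ 2 = be' by rewrite !sqr_sqrtc.
  have ad : a * d = 1.
    have -> : a * d = (S ^+ 2 - T ^+ 2) / 4 by rewrite /a /d; field.
    by rewrite SS TT; field.
  have dA : 1 * 1 - 1 * 0 = 1 :> K by ring.
  have dB : a * d - l * 0 = 1 by rewrite ad mulr0 subr0.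
  have trA : \tr (mx22 1 1 0 1 : 'M[K]_2) = 2 by rewrite mx22_tr.
  rewrite (word_SL2 _ _ 0 0) ?mx22_det //.
  + rewrite trA (inv_mx22 dB) oppr0 comb_common_fixpoint -?ev_r //.
    congr (mx22 1 (_ - _ * _) 0 1).
    have -> : a ^+ 2 = (S ^+ 2 + T ^+ 2 + 2 * (T * S)) / 4 by rewrite /a; field.
    by rewrite SS TT; field.
  + by rewrite trA; ring.
  + rewrite (inv_mx22 dA) (inv_mx22 dB) !mx22M mx22_tr.
    transitivity (2 * (a * d) - 2); first by ring.
    by rewrite ad; ring.
Qed.
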